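(* Let $C$ be a bivariate copula and let $\rho=\rho(C)\in[-1,1]$ be its Spearman's rho. Then Blomqvist's beta $\beta(C)$ satisfies $\ell(\rho)\leqslant\beta(C)\leqslant h(\rho)$, where $$\ell(\rho)=\begin{cases}-1, & \text{if } \rho\leqslant-\frac12,\\ 1-2\sqrt[3]{\dfrac{2(1-\rho)}{3}}, & \text{otherwise,}\end{cases}\qquad h(\rho)=\begin{cases}1, & \text{if } \rho\geqslant\frac12,\\ -1+2\sqrt[3]{\dfrac{2(1+\rho)}{3}}, & \text{otherwise.}\end{cases}$$
   Context: A bivariate copula is a function $C:[0,1]^2\to[0,1]$ with $C(u,0)=C(0,v)=0$, $C(u,1)=u$, $C(1,v)=v$, that is 2-increasing. Blomqvist's beta: $\beta(C)=4C\left(\tfrac12,\tfrac12\right)-1$. Concordance function: for copulas $C_1,C_2$, $\mathcal{Q}(C_1,C_2)=4\int_{[0,1]^2}C_2(u,v)\,dC_1(u,v)-1$, where $dC_1$ denotes integration with respect to the probability measure on $[0,1]^2$ with distribution function $C_1$. Spearman's rho: $\rho(C)=3\mathcal{Q}(C,\Pi)$, where $\Pi(u,v)=uv$. *)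

(* Defs.v *)
From HB Require Import structures.
From mathcomp Require Import all_boot all_order all_algebra.
From mathcomp Require Import all_classical all_reals all_analysis.

Set Implicit Arguments.
Unset Strict Implicit.
Unset Printing Implicit Defensive.

Import Order.TTheory GRing.Theory Num.Theory.
Import numFieldNormedType.Exports.

Local Open Scope classical_set_scope.
Local Open Scope ring_scope.

(* A function on the unit square is a function [R -> R -> R] whose values     *)
(* outside the square are left unconstrained; they never enter below.         *)
Record is_copula (R : realType) (C : R -> R -> R) : Prop := IsCopula {
  copula_range : forall u v : R, 0 <= u <= 1 -> 0 <= v <= 1 -> 0 <= C u v <= 1 ;
  copula_u0 : forall u : R, 0 <= u <= 1 -> C u 0 = 0 ;
  copula_0v : forall v : R, 0 <= v <= 1 -> C 0 v = 0 ;
  copula_u1 : forall u : R, 0 <= u <= 1 -> C u 1 = u ;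
  copula_1v : forall v : R, 0 <= v <= 1 -> C 1 v = v ;
  copula_2increasing : forall u1 u2 v1 v2 : R,
    0 <= u1 -> u1 <= u2 -> u2 <= 1 -> 0 <= v1 -> v1 <= v2 -> v2 <= 1 ->
    0 <= C u2 v2 - C u2 v1 - C u1 v2 + C u1 v1 }.

Definition indep_copula (R : realType) (u v : R) : R := u * v.

Definition blomqvist_beta (R : realType) (C : R -> R -> R) : R :=
  4 * C 2^-1 2^-1 - 1.

Definition plane (R : realType) := (measurableTypeR R * measurableTypeR R)%type.

(* For a copula [C], u = v = 1 shows that [mu] is carried by the unit square. *)
Definition has_joint_cdf (R : realType) (C : R -> R -> R)
    (mu : probability (plane R) R) : Prop :=
  forall u v : R, 0 <= u <= 1 -> 0 <= v <= 1 ->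
    mu (`[0, u] `*` `[0, v]) = (C u v)%:E.

(* The probability measure with distribution function [C]. It exists and is   *)
(* unique when [C] is a copula (2-increasing and continuous, the latter being *)
(* a consequence of the axioms); the default value of [get] matters only for  *)
(* functions that are not copulas.                                            *)
Definition copula_measure (R : realType) (C : R -> R -> R) :
    probability (plane R) R :=
  [get mu : probability (plane R) R | has_joint_cdf C mu].

Definition concordance (R : realType) (C1 C2 : R -> R -> R) : R :=
  4 * (\int[copula_measure C1]_(x in `[0, 1] `*` `[0, 1]) C2 x.1 x.2) - 1.

Definition spearman_rho (R : realType) (C : R -> R -> R) : R :=
  3 * concordance C (@indep_copula R).

(* [a `^ p] is the usual power only for [0 <= a]; this is the real cube root  *)
(* on the whole line.                                                         *)
Definition cbrt (R : realType) (x : R) : R := Num.sg x * `|x| `^ 3^-1.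

Definition beta_lower (R : realType) (rho : R) : R :=
  if rho <= - 2^-1 then -1 else 1 - 2 * cbrt (2 * (1 - rho) / 3).

Definition beta_upper (R : realType) (rho : R) : R :=
  if 2^-1 <= rho then 1 else -1 + 2 * cbrt (2 * (1 + rho) / 3).

(* Main.v *)
Require Import Defs.
From HB Require Import structures.
From mathcomp Require Import all_boot all_order all_algebra.
From mathcomp Require Import all_classical all_reals all_analysis.
From mathcomp Require Import measurable_realfun.
From mathcomp Require Import ring lra.
Import Order.TTheory GRing.Theory Num.Theory.
Import numFieldNormedType.Exports.
Local Open Scope classical_set_scope.
Local Open Scope ring_scope.

(* Existence of the probability of a copula C: for each v the function C(., v) *)
(* is nondecreasing and 1-Lipschitz, so its Lebesgue-Stieltjes measure has a   *)
(* Radon-Nikodym density f_v, and f_v <= f_w a.e. for v <= w. The hypographs   *)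
(* S_v of the f_v are thus nested up to null sets, with S_v having mass C(u,v) *)
(* above ]0, u]. Restrict the plane Lebesgue measure to S_1 and push it        *)
(* forward by (s, t) |-> (s, Y(s, t)) with Y(s, t) = inf {q | t <= f_q(s)},    *)
(* q ranging over the rationals of [0, 1].                                     *)
(* Inequality: with U, V uniform of joint law C and a = C(1/2, 1/2),           *)
(* E[UV] = 1/6 + E[(U + V - 1)^2] / 2. The pair (U, V) lies with probability   *)
(* a in each of the two diagonal quadrants around (1/2, 1/2), where            *)
(* |U + V - 1| = |U - 1/2| + |V - 1/2| =: s. Now s^2 >= 2 a s - a^2, and       *)
(* uniformity of the marginals bounds E|U - 1/2| below on an event of given    *)
(* mass, through E[(a - |U - 1/2|)^+] = a^2; this yields E[UV] >= 1/6 + a^3.   *)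
(* The upper bound E[UV] <= 1/3 - (1/2 - a)^3 comes in the same way from       *)
(* (U - V)^2 and the two antidiagonal quadrants, of mass 1/2 - a each.         *)

(** With [I] = E[UV] one has rho = 12 [I] - 3 and beta = 4 a - 1, where a = C(1/2, 1/2). The theorem
    is therefore the pair of inequalities 1/6 + a^3 <= [I] <= 1/3 - (1/2 - a)^3
    ([copula_product_bounds]), solved for a through cube roots ([le_cbrt]). The two inequalities
    follow the scheme of linear programming duality: [product_lower_bound] and [product_upper_bound]
    compare [x * y] pointwise with indicators of quadrants and functions of one variable.
    Integration turns the indicators into masses a or 1/2 - a, and the functions of one variable
    into Lebesgue integrals, because the marginals are uniform ([integral_add_marginals]). For this
    to concern [copula_measure C], defined by choice, some probability with distribution function
    [C] must exist: [copula_measure_exists]. *)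

Lemma le_lebesgue_stieltjes (R : realType) (F G : cumulative R R) :
  (forall a b, a <= b -> F b - F a <= G b - G a) ->
  forall A, (lebesgue_stieltjes_measure F A <= lebesgue_stieltjes_measure G A)%E.
Proof.
move=> FG A.
rewrite /lebesgue_stieltjes_measure /measure_extension /mu_ext.
(* Both sides are outer measures, that is infima over the same countable covers by half-open
   intervals; each cover costs less for [F] than for [G]. Hence [A] is arbitrary. *)
apply: le_ereal_inf_tmp => _ [I [mI AI] <-].
apply: (@le_trans _ _ (\sum_(k <oo) wlength F (I k))%E).
  by apply: ereal_inf_lbound; exists I.
apply: lee_nneseries => [k _ _|k _]; first exact: wlength_ge0.
have [[a b] _ <-] := mI k => /=.
have [ab|ab] := leP a b; first by rewrite !wlength_itv_bnd// lee_fin FG.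
by rewrite set_itv_ge ?wlength0// bnd_simp -leNgt ltW.
Qed.

Lemma lebesgue_stieltjes_oc (R : realType) (F : cumulative R R) (a b : R) :
  a <= b -> lebesgue_stieltjes_measure F `]a, b] = (F b - F a)%:E.
Proof.
move=> ab; rewrite /lebesgue_stieltjes_measure /measure_extension/=.
by rewrite measurable_mu_extE/= ?wlength_itv_bnd//; exact: is_ocitv.
Qed.

Lemma lebesgue_stieltjes_density (R : realType) (F : cumulative R R) (D : set R) :
  measurable (D : set (measurableTypeR R)) -> (lebesgue_measure D < +oo)%E ->
  (forall a b, a <= b -> F b - F a <= b - a) ->
  exists f : R -> R, [/\ measurable_fun setT f, forall x, 0 <= f x &
    forall A : set (measurableTypeR R), measurable A ->
    (\int[lebesgue_measure]_(x in A) (f x)%:E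
      = lebesgue_stieltjes_measure F (A `&` D))%E].
Proof.
move=> mD Doo Fid.
have le_leb A : (lebesgue_stieltjes_measure F A <= lebesgue_measure A)%E.
  exact: le_lebesgue_stieltjes.
have FDoo : (lebesgue_stieltjes_measure F D < +oo)%E.
  exact: le_lt_trans Doo.
(* Cutting down to [D] makes the measure finite, and the comparison with Lebesgue measure makes it
   absolutely continuous, so Radon-Nikodym applies. *)
pose nu : {finite_measure set _ -> \bar R} := mfrestr mD FDoo.
have nu_dom : nu `<< @lebesgue_measure R.
  apply/null_content_dominatesP => A mA A0; apply/eqP.
  rewrite -measure_le0 -A0 (le_trans (le_leb _))//.
  by apply: le_measure; rewrite ?inE//; exact: measurableI.
have [f [f0 ffin fint fE]] := radon_nikodym_sigma_finite nu_dom.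
exists (fine \o f); split.
- apply: (measurableT_comp (@fine_measurable R setT measurableT)).
  exact: (measurable_int _ fint).
- by move=> x; exact: fine_ge0.
- move=> A mA; apply: etrans (esym (fE A mA)); apply: eq_integral => x _ /=.
  by rewrite fineK.
Qed.

(** * Sections of a copula: monotone and 1-Lipschitz *)

Lemma copula_increment_mono {R : realType} {C : R -> R -> R} (hC : is_copula C)
    {u1 u2 v1 v2 : R} : 0 <= u1 -> u1 <= u2 -> u2 <= 1 ->
  0 <= v1 -> v1 <= v2 -> v2 <= 1 -> C u2 v1 - C u1 v1 <= C u2 v2 - C u1 v2.
Proof.
move=> a b c d e f.
have := copula_2increasing hC a b c d e f; lra.
Qed.

(** Compare with the level v = 0, where the increment vanishes. *)
Lemma copula_increment_ge0 {R : realType} {C : R -> R -> R} (hC : is_copula C)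
    {u1 u2 v : R} : 0 <= u1 -> u1 <= u2 -> u2 <= 1 -> 0 <= v <= 1 ->
  0 <= C u2 v - C u1 v.
Proof.
move=> a b c /andP[d e].
have := copula_increment_mono hC a b c (lexx 0) d e.
by rewrite !(copula_u0 hC) ?subrr//; apply/andP; split; lra.
Qed.

(** Compare with the level v = 1, where the uniform marginal makes the increment equal to
    [u2 - u1]. *)
Lemma copula_increment_le {R : realType} {C : R -> R -> R} (hC : is_copula C)
    {u1 u2 v : R} : 0 <= u1 -> u1 <= u2 -> u2 <= 1 -> 0 <= v <= 1 ->
  C u2 v - C u1 v <= u2 - u1.
Proof.
move=> a b c /andP[d e].
have := copula_increment_mono hC a b c d e (lexx 1).
by rewrite !(copula_u1 hC)//; apply/andP; split; lra.
Qed.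

Lemma copula_transpose {R : realType} {C : R -> R -> R} : is_copula C ->
  is_copula (fun u v => C v u).
Proof.
move=> hC; split => /=.
- by move=> u v hu hv; exact: copula_range.
- exact: copula_0v.
- exact: copula_u0.
- exact: copula_1v.
- exact: copula_u1.
- move=> u1 u2 v1 v2 a b c d e f.
  have := copula_2increasing hC d e f a b c; lra.
Qed.

(** A copula is unconstrained off the unit square; clamping extends its sections to cumulative
    functions on the line. By itself it is the distribution function of the uniform law on
    [0, 1]. *)
Definition clamp01 {R : realType} (x : R) : R := Num.max 0 (Num.min 1 x).

Lemma clamp01_itv {R : realType} (x : R) : 0 <= clamp01 x <= 1.
Proof.
rewrite /clamp01 maxEle minEle.
by case: (leP 1 x) => ?; case: ifPn; rewrite -?ltNge; lra.
Qed.

Lemma clamp01_id {R : realType} (x : R) : 0 <= x <= 1 -> clamp01 x = x.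
Proof.
rewrite /clamp01 maxEle minEle.
by case: (leP 1 x) => ?; case: ifPn; rewrite -?ltNge; lra.
Qed.

Lemma clamp01_increment {R : realType} {x y : R} : x <= y ->
  0 <= clamp01 y - clamp01 x <= y - x.
Proof.
rewrite /clamp01 !maxEle !minEle.
by case: (leP 1 x) => ?; case: (leP 1 y) => ?; do !case: ifPn; rewrite -?ltNge; lra.
Qed.

Lemma lipschitz_cumulative {R : realType} (f : R -> R) :
  (forall x y, x <= y -> 0 <= f y - f x <= y - x) ->
  exists F : cumulative R R, forall x, F x = f x.
Proof.
move=> incr.
have nd : nondecreasing f by move=> x y /incr; lra.
have rc : right_continuous f.
  apply: right_continuousW => x; apply/cvgrPdist_lt => e e0.
  near=> y; have : `|x - y| < e by near: y; exact: cvgr_dist_lt.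
  have [xy|/ltW xy] := leP x y; have := incr _ _ xy => /andP[h1 h2].
    rewrite !ler0_norm; lra.
  rewrite !ger0_norm; lra.
by exists (HB.pack_for (cumulative R R) f (isCumulative.Build R _ R f nd rc)).
Unshelve. all: by end_near. Qed.

Lemma copula_section_cumulative {R : realType} {C : R -> R -> R} (hC : is_copula C)
    (v : R) : 0 <= v <= 1 ->
  exists F : cumulative R R, forall x, F x = C (clamp01 x) v.
Proof.
move=> v01; apply: lipschitz_cumulative => x y xy.
have /andP[x0 x1] := clamp01_itv x.
have /andP[y0 y1] := clamp01_itv y; have /andP[h1 h2] := clamp01_increment xy.
have xy' : clamp01 x <= clamp01 y by lra.
have := copula_increment_ge0 hC x0 xy' y1 v01.
by have := copula_increment_le hC x0 xy' y1 v01; lra.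
Qed.

Lemma copula_density {R : realType} {C : R -> R -> R} (hC : is_copula C) :
  exists f : R -> R -> R, forall v, 0 <= v <= 1 ->
  [/\ measurable_fun setT (f v), forall x, 0 <= f v x,
    forall u, 0 <= u <= 1 ->
      (\int[lebesgue_measure]_(x in `]0%R, u]) (f v x)%:E = (C u v)%:E)%E &
    forall w (A : set (measurableTypeR R)), v <= w <= 1 -> measurable A ->
      (\int[lebesgue_measure]_(x in A) (f v x)%:E
        <= \int[lebesgue_measure]_(x in A) (f w x)%:E < +oo)%E].
Proof.
pose D : set (measurableTypeR R) := `]0%R, 1%R]%classic.
have mD : measurable D by exact: measurable_itv.
have Doo : (lebesgue_measure D < +oo)%E.
  by rewrite lebesgue_measure_itv/= lte_fin ltr01 oppr0 adde0 ltry.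
have cumul v : exists F : cumulative R R,
    0 <= v <= 1 -> forall x, F x = C (clamp01 x) v.
  (* [choice] needs a total family; off [0, 1] any cumulative function will do. *)
  have [v01|v01] := boolP (0 <= v <= 1); last by exists idfun.
  by have [F FE] := copula_section_cumulative hC v v01; exists F.
have [F FE] := choice cumul.
have Fid v : 0 <= v <= 1 -> forall a b, a <= b -> F v b - F v a <= b - a.
  move=> v01 a b ab; rewrite !FE//.
  have /andP[a0 a1] := clamp01_itv a; have /andP[b0 b1] := clamp01_itv b.
  have /andP[h1 h2] := clamp01_increment ab.
  have ab' : clamp01 a <= clamp01 b by lra.
  have := copula_increment_le hC a0 ab' b1 v01; lra.
have dens v : exists f : R -> R, 0 <= v <= 1 -> [/\ measurable_fun setT f,
    forall x, 0 <= f x & forall A : set (measurableTypeR R), measurable A ->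
    (\int[lebesgue_measure]_(x in A) (f x)%:E
      = lebesgue_stieltjes_measure (F v) (A `&` D))%E].
  have [v01|v01] := boolP (0 <= v <= 1); last by exists (fun=> 0).
  have [f hf] := lebesgue_stieltjes_density _ (F v) D mD Doo (Fid _ v01).
  by exists f.
have [f fE] := choice dens.
exists f => v v01; have [mf f0 If] := fE v v01; split => //.
- move=> u /andP[u0 u1]; rewrite If; last exact: measurable_itv.
  rewrite setIidl; last first.
    by move=> x; rewrite /D/= !in_itv/= => /andP[-> xu]/=; exact: le_trans u1.
  rewrite lebesgue_stieltjes_oc// !FE// !clamp01_id ?copula_0v ?subr0//.
    by rewrite lexx ler01.
  by rewrite u0.
- move=> w A /andP[vw w1] mA; have /andP[v0 v1] := v01.
  have w01 : 0 <= w <= 1 by rewrite w1 (le_trans v0).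
  have [_ _ Ifw] := fE w w01; rewrite If// Ifw//; apply/andP; split.
    apply: le_lebesgue_stieltjes => a b ab; rewrite !FE//.
    have /andP[a0 a1] := clamp01_itv a; have /andP[b0 b1] := clamp01_itv b.
    have /andP[h1 h2] := clamp01_increment ab.
    have ab' : clamp01 a <= clamp01 b by lra.
    exact: copula_increment_mono.
  apply: le_lt_trans Doo; apply: (@le_trans _ _ (lebesgue_measure (A `&` D))).
    by apply: le_lebesgue_stieltjes => a b ab; exact: Fid.
  by apply: le_measure; rewrite ?inE//; exact: measurableI.
Qed.

(** * Almost everywhere comparison of densities, and hypographs *)

Lemma measurable_set_ler (R : realType) d (T : measurableType d) (f g : T -> R) :
  measurable_fun setT f -> measurable_fun setT g ->
  measurable [set x | f x <= g x].
Proof.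
move=> mf mg; rewrite -[X in measurable X]setTI.
have := measurable_fun_ler mf mg.
by move=> /(_ measurableT [set true] I); congr measurable; apply/seteqP; split.
Qed.

Lemma measurable_set_ltr (R : realType) d (T : measurableType d) (f g : T -> R) :
  measurable_fun setT f -> measurable_fun setT g ->
  measurable [set x | f x < g x].
Proof.
move=> mf mg; rewrite -[X in measurable X]setTI.
have := measurable_fun_ltr mf mg.
by move=> /(_ measurableT [set true] I); congr measurable; apply/seteqP; split.
Qed.

(** On subsets of [g < f] the integrals of [f] and [g] are ordered both ways, hence equal. They are
    finite, so [f = g] almost everywhere on that set, where equality never holds. *)
Lemma le_integral_null (R : realType) d (T : measurableType d)
    (mu : {measure set T -> \bar R}) (f g : T -> R) :
  measurable_fun setT f -> measurable_fun setT g ->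
  (forall x, 0 <= f x) -> (forall x, 0 <= g x) ->
  (forall A, measurable A ->
    (\int[mu]_(x in A) (f x)%:E <= \int[mu]_(x in A) (g x)%:E < +oo)%E) ->
  mu [set x | g x < f x] = 0%E.
Proof.
move=> mf mg f0 g0 fg; set D := [set x | g x < f x].
have mD : measurable D by exact: measurable_set_ltr.
have mfE : measurable_fun setT (EFin \o f) by exact/measurable_EFinP.
have mgE : measurable_fun setT (EFin \o g) by exact/measurable_EFinP.
have iD (E : set T) : E `<=` D -> measurable E ->
    (\int[mu]_(x in E) (f x)%:E = \int[mu]_(x in E) (g x)%:E)%E.
  move=> ED mE; apply/eqP; rewrite eq_le; have /andP[-> _] /= := fg _ mE.
  apply: ge0_le_integral => //.
  - by move=> x _; rewrite lee_fin.
  - exact: measurable_funTS.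
  - exact: measurable_funTS.
  - by move=> x /ED; rewrite lee_fin => /ltW.
have : ae_eq mu D (EFin \o f) (EFin \o g).
  apply: integral_ae_eq => //; last exact: measurable_funTS.
  apply/integrableP; split; first exact: measurable_funTS.
  under eq_integral do rewrite /= ger0_norm//.
  by have /andP[/le_lt_trans] := fg _ mD; exact.
move=> [N [mN N0 DN]]; apply/eqP; rewrite -measure_le0 -N0.
apply: le_measure; rewrite ?inE// => x Dx; apply: DN => /=.
by move=> /(_ Dx) [] fgx; move: Dx; rewrite /D/= fgx ltxx.
Qed.

Definition hypograph {R : realType} (D : set R) (g : R -> R) : set (plane R) :=
  [set p | D p.1 /\ 0 < p.2 <= g p.1].

Lemma measurable_hypograph (R : realType) (D : set (measurableTypeR R)) (g : R -> R) :
  measurable D -> measurable_fun setT g -> measurable (hypograph D g).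
Proof.
move=> mD mg.
have -> : hypograph D g = fst @^-1` D `&`
    ([set p : plane R | 0 < p.2] `&` [set p : plane R | p.2 <= g p.1]).
  by apply/seteqP; split => [p [? /andP[]]//|p [? [? ?]]]; split => //; apply/andP.
apply: measurableI.
  by rewrite -[X in measurable X]setTI; exact: measurable_fst.
apply: measurableI.
- by apply: measurable_set_ltr => //; exact: measurable_snd.
- apply: measurable_set_ler; first exact: measurable_snd.
  by apply: measurableT_comp => //; exact: measurable_fst.
Qed.

(** Cavalieri: the fibre above a point [x] of [D] is []0, g x]], of length [g x], and the other
    fibres are empty. *)
Lemma lebesgue_hypograph (R : realType) (D : set (measurableTypeR R)) (g : R -> R) :
  measurable D -> measurable_fun setT g -> (forall x, 0 <= g x) ->
  ((@lebesgue_measure R \x @lebesgue_measure R) (hypograph D g)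
    = \int[lebesgue_measure]_(x in D) (g x)%:E)%E.
Proof.
move=> mD mg g0; rewrite /product_measure1 /= [RHS]integral_mkcond.
apply: eq_integral => x _ /=; rewrite patchE; case: ifPn => xD.
  rewrite (_ : xsection _ _ = `]0%R, g x]%classic).
    rewrite lebesgue_measure_itv/= lte_fin oppr0 adde0.
    by case: ltP => // gx; congr EFin; apply/eqP; rewrite eq_le g0 gx.
  apply/seteqP; split => y; rewrite /xsection/=.
    by rewrite inE => -[_ yg]; rewrite in_itv.
  by rewrite in_itv/= => h; rewrite inE; split => //; exact: set_mem.
rewrite (_ : xsection _ _ = set0) ?measure0//.
apply/seteqP; split => y //; rewrite /xsection/= inE => -[/= Dx _].
by move: xD; rewrite notin_setE.
Qed.

(** * Existence of the probability measure of a copula *)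

Lemma rat_between01 {R : realType} (a b : R) : 0 <= a -> a < b -> b <= 1 ->
  exists n, a < clamp01 (ratr (odflt 0 (unpickle n : option rat)) : R) < b.
Proof.
move=> a0 ab b1; have [q] := rat_in_itvoo ab; rewrite in_itv/= => /andP[aq qb].
exists (pickle q); rewrite pickleK/= clamp01_id ?aq ?qb//.
by apply/andP; split; apply: ltW; [exact: le_lt_trans aq|exact: lt_le_trans b1].
Qed.

Lemma copula_measure_exists {R : realType} {C : R -> R -> R} (hC : is_copula C) :
  exists mu : probability (plane R) R, has_joint_cdf C mu.
Proof.
have [f fE] := copula_density hC.
pose leb2 : {measure set (plane R) -> \bar R} :=
  (@lebesgue_measure R \x @lebesgue_measure R)%E.
(* [q] enumerates the rationals of [0, 1] with repetitions; codes of no rational give 0. *)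
pose q n : R := clamp01 (ratr (odflt 0 (unpickle n : option rat))).
have q01 n : 0 <= q n <= 1 by exact: clamp01_itv.
pose U u : set (measurableTypeR R) := `]0%R, u]%classic.
have mU u : measurable (U u) by exact: measurable_itv.
pose S v := hypograph (U 1) (f v).
have one01 : 0 <= (1 : R) <= 1 by rewrite ler01 lexx.
have mS v : 0 <= v <= 1 -> measurable (S v).
  by move=> /fE[mf _ _ _]; exact: measurable_hypograph.
have leb2S u v : 0 <= u <= 1 -> 0 <= v <= 1 ->
    leb2 (hypograph (U u) (f v)) = (C u v)%:E.
  move=> u01 v01; have [mf f0 fI _] := fE v v01.
  by rewrite -fI// -lebesgue_hypograph.
(* A point of [S v] outside [S w] lies above some s with [f w s < f v s]; such s form a null set,
   and so does the cylinder over it. *)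
have SS v w : 0 <= v <= 1 -> 0 <= w <= 1 -> v <= w -> leb2 (S v `\` S w) = 0%E.
  move=> v01 w01 vw; have [mf f0 _ fI] := fE v v01; have [mg g0 _ _] := fE w w01.
  have /andP[w0 w1] := w01.
  have null : lebesgue_measure [set x | f w x < f v x] = 0%E.
    apply: le_integral_null => // A mA; apply: fI => //.
    by rewrite vw.
  apply/eqP; rewrite -measure_le0.
  apply: (@le_trans _ _ (leb2 ([set x | f w x < f v x] `*` setT))).
    apply: le_measure; rewrite ?inE.
    - by apply: measurableD; [exact: (mS _ v01)|exact: (mS _ w01)].
    - by apply: measurableX => //; exact: measurable_set_ltr.
    - move=> [s t] [/= [Us /= /andP[t0 tv]]] nS; split => //=.
      rewrite ltNge; apply/negP => vws; apply: nS; split => //=.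
      by rewrite t0 (le_trans tv).
  rewrite /leb2/= product_measure1E//; last exact: measurable_set_ltr.
  by rewrite [X in (X * _)%E]null mul0e.
have leb2S1 : leb2 (S 1) = 1%E by rewrite leb2S ?copula_u1.
pose base := mrestr leb2 (mS 1 one01).
have baseT : base setT = 1%E by rewrite /base /mrestr setTI.
pose P := HB.pack_for (probability (plane R) R) base
  (Measure_isProbability.Build _ _ R base baseT).
(* The value 1 above the graph keeps every infimum in [0, 1], and makes [h n p < r <= 1] force [p]
   below the graph of [f (q n)]. *)
pose h n (p : plane R) : R := if p.2 <= f (q n) p.1 then q n else 1.
have mh n : measurable_fun setT (h n).
  apply: measurable_fun_if => //; last first.
  apply: measurable_fun_ler => //.
  apply: measurableT_comp => //.
  by have [] := fE _ (q01 n).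
have h01 n p : 0 <= h n p <= 1 by rewrite /h; case: ifP => _.
have lbh (p : plane R) : has_lbound (range (h ^~ p)).
  by exists 0 => _ [n _ <-]; have /andP[] := h01 n p.
(* Y (s, .) is the quantile function of the conditional law with cdf f_v(s). *)
pose Y p := infs (h ^~ p) 0.
have mY : measurable_fun setT Y by exact: measurable_fun_infs.
have YltE p r : Y p < r <-> exists n, h n p < r.
  have /seteqP[YE EY] := @infs_preimage R (plane R) setT r h 0%N (fun t _ => lbh t).
  split => [Ypr|[n hn]].
    have [|_ [n _ /=]] := YE p; last by rewrite in_itv/= => ?; exists n.
    by split => //=; rewrite in_itv.
  have [|_] := EY p; last by rewrite /= in_itv.
  by split => //; exists n => //=; rewrite in_itv.
have Yle n p : Y p <= h n p.
  rewrite leNgt; apply/negP => hY.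
  by have := proj2 (YltE p (Y p)) (ex_intro _ n hY); rewrite ltxx.
have Y0 p : 0 <= Y p.
  rewrite leNgt; apply/negP => /YltE[n]; have /andP[h0 _] := h01 n p.
  by rewrite ltNge h0.
have Y1 p : Y p <= 1 by have /andP[_] := h01 0%N p; exact: le_trans.
pose X p : plane R := (p.1, Y p).
have mX : measurable_fun setT X by exact: measurable_fun_pair.
pose XM : {mfun plane R >-> plane R} := HB.pack_for {mfun plane R >-> plane R} X
  (isMeasurableFun.Build _ _ _ _ X mX).
exists (distribution P XM) => u v u01 v01.
have /andP[u0 u1] := u01; have /andP[v0 v1] := v01.
rewrite /distribution /pushforward/= /base /mrestr.
set E := (X in leb2 X).
have EE : E = [set p | S 1 p /\ p.1 <= u /\ Y p <= v].
  apply/seteqP; split=> [p [[/=]]|p [Sp [pu Yv]]].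
    by rewrite !in_itv/= => /andP[_ ?] /andP[_ ?] ?.
  split => //; split; rewrite /= in_itv/= ?pu ?Yv ?Y0 ?andbT//.
  by case: Sp; rewrite /U/= in_itv/= => /andP[/ltW].
have mE : measurable E.
  rewrite EE; apply: measurableI; first exact: (mS 1 one01).
  by apply: measurableI; apply: measurable_set_ler => //; exact: measurable_fst.
have SU w p : hypograph (U u) (f w) p <-> S w p /\ p.1 <= u.
  rewrite /S /hypograph/U/= !in_itv/=; split => [[/andP[-> pu] ->]|[[/andP[-> _] ->] ->]//].
  by rewrite pu (le_trans pu).
have mH w : 0 <= w <= 1 -> measurable (hypograph (U u) (f w)).
  by move=> /fE[mf _ _ _]; exact: measurable_hypograph.
have lower n : q n <= v -> ((C u (q n))%:E <= leb2 E)%E.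
  move=> qv; rewrite -leb2S//.
  have null : leb2 (S (q n) `\` S 1) = 0%E by apply: SS => //; have /andP[] := q01 n.
  rewrite -[leRHS]adde0 -null.
  have mSS : measurable (S (q n) `\` S 1).
    by apply: measurableD; [exact: (mS _ (q01 n))|exact: (mS _ one01)].
  apply: le_trans (measureU2 leb2 mE mSS).
  apply: le_measure; rewrite ?inE.
  - exact: mH.
  - exact: measurableU.
  - move=> p /SU[Sp pu]; have [S1p|S1p] := pselect (S 1 p); last by right.
    left; rewrite EE; split => //; split => //.
    apply: le_trans (Yle n p) _; rewrite /h; case: ifPn => //.
    by case: Sp => _ /andP[_ ->].
(* If [Y p <= v < q n], some [q k < q n] has [p] in [S (q k)], hence in [S (q n)] outside [N k].
   Countability of the levels keeps the union of the exceptional sets null. *)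
have upper n : v < q n -> (leb2 E <= (C u (q n))%:E)%E.
  move=> vq; rewrite -leb2S//.
  pose N k := if q k < q n then S (q k) `\` S (q n) else set0.
  have mN k : measurable (N k).
    rewrite /N; case: ifP => // _.
    by apply: measurableD; [exact: (mS _ (q01 k))|exact: (mS _ (q01 n))].
  have null : leb2 (\bigcup_k N k) = 0%E.
    apply/negligibleP; first exact: bigcupT_measurable.
    apply: negligible_bigcup => k; apply/negligibleP => //.
    by rewrite /N; case: ifP => // qkn; apply: SS => //; exact: ltW.
  rewrite -[leRHS]adde0 -null.
  apply: le_trans (measureU2 leb2 (mH _ (q01 n)) (bigcupT_measurable N mN)).
  apply: le_measure; rewrite ?inE//.
  - by apply: measurableU; [exact: mH|exact: bigcupT_measurable].
  - move=> p; rewrite EE => -[S1p [pu Yv]].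
    have [k hk] := proj1 (YltE p (q n)) (le_lt_trans Yv vq).
    have [Sqn|Sqn] := pselect (S (q n) p); first by left; apply/SU.
    right; exists k => //; move: hk; rewrite /N /h; case: ifPn => [pk qkn|_].
      rewrite qkn; split => //; case: S1p => U1 /andP[p0 _].
      by split => //; rewrite p0.
    by rewrite ltNge; have /andP[_ ->] := q01 n.
(* The levels [q n] squeeze [v] from both sides, and [C u] is 1-Lipschitz by transposition. The ends
   are separate: at v = 1 no level lies above, and [E] sits in the hypograph of [f 1]; at v = 0 the
   lower bound is 0. *)
apply/eqP; rewrite eq_le; apply/andP; split.
- have [v1'|v1'] := ltP v 1; last first.
    have -> : v = 1 by apply/eqP; rewrite eq_le v1.
    rewrite -leb2S//; apply: le_measure; rewrite ?inE//; first exact: mH.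
    by rewrite EE => p [Sp [pu _]]; exact/SU.
  apply/lee_addgt0Pr => e e0.
  have [||n /andP[vq qve]] := rat_between01 v (Num.min 1 (v + e)) v0.
  - by rewrite lt_min v1' ltrDl.
  - by rewrite ge_min lexx.
  apply: le_trans (upper _ vq) _; rewrite -EFinD lee_fin.
  have := copula_increment_le (copula_transpose hC) v0 (ltW vq) (proj2 (andP (q01 n))) u01.
  move: qve; rewrite lt_min -/(q n) => /andP[_]; lra.
- have [v0'|v0'] := ltP 0 v; last first.
    have -> : v = 0 by apply/eqP; rewrite eq_le v0'.
    by rewrite copula_u0.
  apply/lee_addgt0Pr => e e0.
  have [||n /andP[vq qv]] := rat_between01 (Num.max 0 (v - e)) v _ _ v1.
  - by rewrite le_max lexx.
  - by rewrite gt_max v0' ltrBlDr ltrDl.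
  apply: le_trans (leeD (lower _ (ltW qv)) (lexx _)); rewrite -EFinD lee_fin.
  have := copula_increment_le (copula_transpose hC) (proj1 (andP (q01 n))) (ltW qv) v1 u01.
  move: vq; rewrite gt_max -/(q n) => /andP[_]; lra.
Qed.

(** * One-dimensional integrals of powers and tents *)

Lemma integral_itv_pow (R : realType) (u w c : R) n : u < w ->
  (\int[lebesgue_measure]_(x in `[u, w]) ((x - c) ^+ n)%:E
    = (((w - c) ^+ n.+1 - (u - c) ^+ n.+1) / n.+1%:R)%:E)%E.
Proof.
move=> uw; pose F : R -> R := n.+1%:R^-1 \*: (@id R - cst c) ^+ n.+1.
have dF (x : R) : is_derive x 1 F ((x - c) ^+ n).
  apply: is_derive_eq.
  rewrite subr0 /= /GRing.scale/= mulr1 mulrA mulVf ?mul1r//.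
have FE x : F x = (x - c) ^+ n.+1 / n.+1%:R by rewrite /F/= exprfctE mulrC.
have cF : continuous F.
  move=> y; apply/differentiable_continuous/derivable1_diffP.
  exact: (@ex_derive _ _ _ _ _ _ _ (dF _)).
rewrite (@continuous_FTC2 _ _ F)//.
- by rewrite !FE -EFinB mulrBl.
- apply: continuous_subspaceT => x.
  apply: (@continuous_comp _ _ _ (fun x : R => x - c) (fun y : R => y ^+ n)).
    by apply: cvgB; [exact: cvg_id|exact: cvg_cst].
  exact: exprn_continuous.
- split => //.
  + apply: cvg_at_right_filter; exact: cF.
  + apply: cvg_at_left_filter; exact: cF.
- move=> x _; rewrite derive1E; exact: (@derive_val _ _ _ _ _ _ _ (dF _)).
Qed.

Lemma integral_ramp (R : realType) (k : R) : 0 <= k <= 1 ->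
  (\int[lebesgue_measure]_(x in `[0%R, 1%R]) (Num.max 0 (x - k))%:E
    = ((1 - k) ^+ 2 / 2)%:E)%E.
Proof.
move=> /andP[k0 k1].
have -> : (\int[lebesgue_measure]_(x in `[0%R, 1%R]) (Num.max 0 (x - k))%:E
    = \int[lebesgue_measure]_(x in `[k, 1%R]) ((x - k) ^+ 1)%:E)%E.
  rewrite integral_mkcond [RHS]integral_mkcond; apply: eq_integral => x _.
  rewrite !patchE !mem_setE !in_itv/= expr1; have [kx|xk] := leP k x.
    rewrite (le_trans k0 kx)/= max_r// subr_ge0//.
  by rewrite max_l ?if_same// subr_le0 ltW.
(* The fundamental theorem of calculus was applied on nondegenerate intervals only; k = 1 leaves a
   single point. *)
have [->|k1'] := eqVneq k 1; last first.
  by rewrite integral_itv_pow ?lt_neqAle ?k1'// subrr expr0n/= subr0.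
by rewrite set_itv1 integral_set1 subrr expr0n/= mul0r.
Qed.

(* The tents are the dual multipliers of the uniform-marginal constraints. *)
Definition tent {R : realType} (a x : R) : R := Num.max 0 (a - `|x - 2^-1|).

Lemma tent_ge0 {R : realType} (a x : R) : 0 <= tent a x.
Proof. by rewrite /tent le_max lexx. Qed.

Lemma measurable_ramp (R : realType) (k : R) :
  measurable_fun setT (fun x : R => Num.max 0 (x - k)).
Proof. by apply: measurable_maxr => //; exact: measurable_funB. Qed.

Lemma measurable_tent (R : realType) (a : R) : measurable_fun setT (tent a).
Proof.
apply: measurable_maxr => //; apply: measurable_funB => //.
by apply: measurableT_comp => //; exact: measurable_funB.
Qed.

Lemma integral_tent (R : realType) (a : R) : 0 <= a <= 2^-1 ->
  (\int[lebesgue_measure]_(x in `[0%R, 1%R]) (tent a x)%:E = (a ^+ 2)%:E)%E.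
Proof.
move=> /andP[a0 a1].
pose r k (x : R) : R := Num.max 0 (x - k).
have r0 k x : 0 <= r k x by rewrite /r le_max lexx.
have mr k : measurable_fun setT (r k) by exact: measurable_ramp.
have Ir k : 0 <= k <= 1 ->
    (\int[lebesgue_measure]_(x in `[0%R, 1%R]) (r k x)%:E = ((1 - k) ^+ 2 / 2)%:E)%E.
  exact: integral_ramp.
have ID (f g : R -> R) : measurable_fun setT f -> measurable_fun setT g ->
    (forall x, 0 <= f x) -> (forall x, 0 <= g x) ->
    (\int[lebesgue_measure]_(x in `[0%R, 1%R]) (f x + g x)%:E =
      \int[lebesgue_measure]_(x in `[0%R, 1%R]) (f x)%:E +
      \int[lebesgue_measure]_(x in `[0%R, 1%R]) (g x)%:E)%E.
  move=> mf mg f0 g0; under eq_integral do rewrite EFinD.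
  rewrite ge0_integralD//.
  - by move=> x _; rewrite lee_fin.
  - by apply: measurable_funTS; exact/measurable_EFinP.
  - by move=> x _; rewrite lee_fin.
  - by apply: measurable_funTS; exact/measurable_EFinP.
(* The tent is the second difference of ramps at 1/2 - a, 1/2, 1/2 + a; writing it with sums only
   avoids subtracting extended reals. *)
have E : (\int[lebesgue_measure]_(x in `[0%R, 1%R])
      (tent a x + (r 2^-1 x + r 2^-1 x))%:E =
    \int[lebesgue_measure]_(x in `[0%R, 1%R])
      (r (2^-1 - a) x + r (2^-1 + a) x)%:E)%E.
  apply: eq_integral => x _; congr EFin.
  rewrite /tent /r !maxEle; have [hx|hx] := leP 0 (x - 2^-1).
    by rewrite (ger0_norm hx); do !case: ifPn; rewrite -?ltNge; lra.
  by rewrite (ltr0_norm hx); do !case: ifPn; rewrite -?ltNge; lra.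
move: E; rewrite !ID//; first last.
- by move=> x; rewrite addr_ge0.
- by move=> x; exact: tent_ge0.
- exact: measurable_funD.
- exact: measurable_tent.
rewrite (Ir 2^-1) ?(Ir (2^-1 - a)) ?(Ir (2^-1 + a)); first last.
- by apply/andP; split; lra.
- by apply/andP; split; lra.
- by apply/andP; split; lra.
case: integral => [t| |]//=; rewrite -!EFinD => -[] h; congr EFin; lra.
Qed.

(* Used for c = 0 and c = 1: expanding (x - y)^2 or (x + y - 1)^2 leaves  *)
(* exactly these quadratic terms in one variable.                         *)
Definition quad_tent {R : realType} (c a x : R) : R :=
  (x - c) ^+ 2 / 2 + a * tent a x.

Lemma quad_tent_ge0 {R : realType} (c a x : R) : 0 <= a -> 0 <= quad_tent c a x.
Proof.
move=> a0; have := sqr_ge0 (x - c); have := mulr_ge0 a0 (tent_ge0 a x).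
rewrite /quad_tent; lra.
Qed.

Lemma measurable_quad_tent (R : realType) (c a : R) :
  measurable_fun setT (quad_tent c a).
Proof.
apply: measurable_funD; apply: measurable_funM => //; last exact: measurable_tent.
by apply: measurable_funX; exact: measurable_funB.
Qed.

Lemma integral_quad_tent (R : realType) (c a : R) : c \in [:: 0; 1] ->
  0 <= a <= 2^-1 ->
  (\int[lebesgue_measure]_(x in `[0%R, 1%R]) (quad_tent c a x)%:E
    = (6^-1 + a ^+ 3)%:E)%E.
Proof.
move=> c01 /andP[a0 a1].
have mq : measurable_fun setT (fun x : R => ((x - c) ^+ 2)%:E).
  by apply/measurable_EFinP/measurable_funX/measurable_funB.
have mt : measurable_fun setT (fun x : R => (tent a x)%:E).
  by apply/measurable_EFinP; exact: measurable_tent.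
transitivity (\int[lebesgue_measure]_(x in `[0%R, 1%R])
    ((2^-1)%:E * ((x - c) ^+ 2)%:E + a%:E * (tent a x)%:E))%E.
  by apply: eq_integral => x _; rewrite -!EFinM -EFinD /quad_tent mulrC.
rewrite ge0_integralD//=; first last.
- by apply: emeasurable_funM => //; exact: measurable_funTS.
- by move=> x _; rewrite mule_ge0// lee_fin// tent_ge0.
- by apply: emeasurable_funM => //; exact: measurable_funTS.
- by move=> x _; rewrite mule_ge0// lee_fin// sqr_ge0.
rewrite !ge0_integralZl//=; first last.
- by move=> x _; rewrite lee_fin sqr_ge0.
- exact: measurable_funTS.
- by move=> x _; rewrite lee_fin tent_ge0.
- exact: measurable_funTS.
rewrite integral_itv_pow// integral_tent ?a0// -!EFinM -EFinD; congr EFin.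
by move: c01; rewrite !inE => /orP[] /eqP ->; field.
Qed.

(** * Uniform marginals *)

Lemma probability_setI1 d (T : measurableType d) (R : realType)
    (P : probability T R) (D A : set T) : measurable D -> P D = 1%E ->
  measurable A -> P (A `&` D) = P A.
Proof.
move=> mD D1 mA; apply/eqP; rewrite eq_le; apply/andP; split.
  by apply: le_measure; rewrite ?inE//; exact: measurableI.
have DC0 : P (~` D) = 0%E by rewrite probability_setC// D1 subee.
rewrite -[leRHS]adde0 -DC0.
apply: (le_trans _ (measureU2 P (measurableI _ _ mA mD) (measurableC mD))).
apply: le_measure; rewrite ?inE//.
  by apply: measurableU; [exact: measurableI|exact: measurableC].
by move=> x Ax; have [Dx|Dx] := pselect (D x); [left|right].
Qed.

Lemma ge0_integral_setI1 d (T : measurableType d) (R : realType)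
    (P : probability T R) (D : set T) (f : T -> \bar R) : measurable D -> P D = 1%E ->
  measurable_fun setT f -> (forall x, 0 <= f x)%E ->
  (\int[P]_(x in D) f x = \int[P]_x f x)%E.
Proof.
move=> mD D1 mf f0.
have DC0 : P (~` D) = 0%E by rewrite probability_setC// D1 subee.
rewrite -[in RHS](setUv D) ge0_integral_setU//; last 3 first.
- exact: measurableC.
- by rewrite setUv.
- exact/disj_set2P/setICr.
rewrite [X in (_ + X)%E]null_set_integral ?adde0//; first exact: measurableC.
exact: measurable_funTS.
Qed.

(** A Lebesgue-Stieltjes measure is determined by its values on []a, b]]. Here [P] is carried by
    [0, 1], so only the clamped endpoints count; u = 0 says that the point 0 has no mass. *)
Lemma probability_uniform_unique (R : realType)
    (P : probability (measurableTypeR R) R) (F : cumulative R R) :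
  (forall x, F x = clamp01 x) ->
  (forall u, 0 <= u <= 1 -> P `[0%R, u]%classic = u%:E) ->
  forall A, measurable A -> lebesgue_stieltjes_measure F A = P A.
Proof.
move=> FE PE; apply: lebesgue_stieltjes_measure_unique => _ [[a b] _ <-] /=.
pose D : set (measurableTypeR R) := `[0%R, 1%R]%classic.
have mD : measurable D by exact: measurable_itv.
have one01 : 0 <= (1 : R) <= 1 by rewrite ler01 lexx.
have D1 : P D = 1%E by rewrite /D PE.
have [ab|ba] := leP a b; last by rewrite set_itv_ge ?measure0// bnd_simp -leNgt ltW.
have ca := clamp01_itv a; have cb := clamp01_itv b.
have mi (i : interval R) : measurable ([set` i] : set (measurableTypeR R)).
  exact: measurable_itv.
rewrite lebesgue_stieltjes_oc// !FE -(probability_setI1 _ _ _ P D)//.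
have [a0|a0] := leP 0 a.
  have -> : `]a, b]%classic `&` D = `[0%R, clamp01 b]%classic `\` `[0%R, clamp01 a]%classic.
    apply/seteqP; split => x; rewrite /D/= !in_itv/=.
      move=> [/andP[ax xb] /andP[x0 x1]]; split.
        rewrite x0/= /clamp01 le_max le_min x1 xb orbT//.
      apply/negP; rewrite x0/= -ltNge /clamp01 gt_max (le_lt_trans a0 ax)/=.
      by rewrite gt_min ax orbT.
    move=> [/andP[x0 xb]] /negP; rewrite x0/= -ltNge => ax.
    have /andP[b0 b1] := cb; rewrite (le_trans xb b1); split => //.
    move: ax xb; rewrite /clamp01 gt_max gt_min le_max le_min; lra.
  rewrite measureD//; last first.
    by rewrite (le_lt_trans (probability_le1 P _)) ?ltry//.
  have sub : `[0%R, clamp01 a]%classic `<=` `[0%R, clamp01 b]%classic.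
    move=> x; rewrite /= !in_itv/= => /andP[-> /le_trans] /=; apply.
    by have := clamp01_increment ab; lra.
  by rewrite (setIidr sub) EFinB -(PE _ ca) -(PE _ cb).
rewrite (_ : clamp01 a = 0) ?subr0; last first.
  by rewrite /clamp01 max_l// ge_min (ltW a0) orbT.
have [b0|b0] := leP 0 b.
  have -> : `]a, b]%classic `&` D = `[0%R, clamp01 b]%classic; last by rewrite PE.
  apply/seteqP; split => x; rewrite /D/= !in_itv/=.
    by move=> [/andP[ax xb] /andP[x0 x1]]; rewrite x0/= /clamp01 le_max le_min x1 xb orbT.
  rewrite /clamp01 le_max le_min; lra.
have -> : `]a, b]%classic `&` D = set0.
  by apply/seteqP; split => // x; rewrite /D/= !in_itv/=; lra.
rewrite measure0 (_ : clamp01 b = 0)//.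
by rewrite /clamp01 max_l// ge_min (ltW b0) orbT.
Qed.

Lemma integral_uniform_marginal d (T : measurableType d) (R : realType)
    (P : probability T R) (X : T -> measurableTypeR R) (g : R -> R) :
  measurable_fun setT X -> measurable_fun setT g -> (forall x, 0 <= g x) ->
  (forall u, 0 <= u <= 1 -> P (X @^-1` `[0%R, u]%classic) = u%:E) ->
  (\int[P]_t (g (X t))%:E = \int[lebesgue_measure]_(x in `[0%R, 1%R]) (g x)%:E)%E.
Proof.
move=> mX mg g0 PX.
pose XM : {mfun T >-> measurableTypeR R} :=
  HB.pack_for {mfun T >-> measurableTypeR R} X (isMeasurableFun.Build _ _ _ _ X mX).
have [F FE] := lipschitz_cumulative (@clamp01 R) (@clamp01_increment R).
have mgE : measurable_fun setT (EFin \o g) by exact/measurable_EFinP.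
rewrite -(@ge0_integral_distribution _ _ _ _ _ P XM (EFin \o g))//=.
transitivity (\int[uniform_prob (@ltr01 R)]_x (g x)%:E)%E.
  apply: eq_measure_integral => A mA _.
  (* The law of [X] and the uniform probability both equal the Lebesgue-Stieltjes measure of
     [clamp01]. *)
  apply: etrans (esym (probability_uniform_unique _ (distribution P XM) F FE PX A mA)) _.
  apply: (probability_uniform_unique _ (uniform_prob (@ltr01 R)) F) => // u /andP[u0 u1].
  apply: etrans (integral_uniform_pdf _ _ _) _; rewrite setIidl; last first.
    by move=> x; rewrite /= !in_itv/= => /andP[-> /le_trans] /=; apply.
  rewrite (eq_integral (cst 1%E)).
    by rewrite integral_cst//= mul1e lebesgue_measure_itv/= lte_fin oppr0 adde0;
      case: ltP => // u0'; congr EFin; apply/eqP; rewrite eq_le u0 u0'.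
  move=> x; rewrite inE/= in_itv/= /uniform_pdf => /andP[-> /le_trans] /= ->//.
  by rewrite subr0 invr1.
by rewrite integral_uniform// subr0 invr1 mul1e.
Qed.

(** * Pointwise bounds for the product *)

(** Replacing each tent by its linear piece, the right side becomes (p + q - a)^2 / 2 + 3 a^2 / 2.
    This is the source of the constant 3/2. *)
Lemma tent_sqr_ge {R : realType} (a x y : R) (p q : R) : 0 <= a ->
  `|x - 2^-1| = p -> `|y - 2^-1| = q ->
  3 / 2 * a ^+ 2 <= (p + q) ^+ 2 / 2 + a * tent a x + a * tent a y.
Proof.
move=> a0 px qy.
have tx : a * (a - p) <= a * tent a x by rewrite ler_wpM2l// /tent px le_max lexx orbT.
have ty : a * (a - q) <= a * tent a y by rewrite ler_wpM2l// /tent qy le_max lexx orbT.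
have := sqr_ge0 (p + q - a); lra.
Qed.

(** Since xy + (x - 1)^2 / 2 + (y - 1)^2 / 2 = 1/2 + (x + y - 1)^2 / 2, [tent_sqr_ge] settles the
    diagonal quadrants; in the others the square and the tents are just nonnegative. *)
Lemma product_lower_bound {R : realType} (a x y : R) : 0 <= a ->
  2^-1 + 3 / 2 * a ^+ 2 * ((x <= 2^-1) && (y <= 2^-1))%:R
    + 3 / 2 * a ^+ 2 * ((2^-1 < x) && (2^-1 < y))%:R
  <= x * y + quad_tent 1 a x + quad_tent 1 a y.
Proof.
move=> a0; rewrite /quad_tent.
have tx := mulr_ge0 a0 (tent_ge0 a x); have ty := mulr_ge0 a0 (tent_ge0 a y).
have s0 := sqr_ge0 (x + y - 1).
have [hx|hx] := leP x 2^-1; have [hy|hy] := leP y 2^-1; rewrite /= ?mulr1 ?mulr0; try lra.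
- have := tent_sqr_ge a x y (2^-1 - x) (2^-1 - y) a0.
  rewrite !ler0_norm; [|lra|lra].
  move=> /(_ ltac:(lra) ltac:(lra)); lra.
- have := tent_sqr_ge a x y (x - 2^-1) (y - 2^-1) a0.
  rewrite !ger0_norm; [|lra|lra].
  move=> /(_ ltac:(lra) ltac:(lra)); lra.
Qed.

(** Same argument with x^2 / 2 + y^2 / 2 - xy = (x - y)^2 / 2, where |x - y| is the sum of the
    distances to 1/2 on the antidiagonal quadrants. *)
Lemma product_upper_bound {R : realType} (b x y : R) : 0 <= b ->
  x * y + 3 / 2 * b ^+ 2 * ((x <= 2^-1) && (2^-1 < y))%:R
    + 3 / 2 * b ^+ 2 * ((2^-1 < x) && (y <= 2^-1))%:R
  <= quad_tent 0 b x + quad_tent 0 b y.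
Proof.
move=> b0; rewrite /quad_tent.
have tx := mulr_ge0 b0 (tent_ge0 b x); have ty := mulr_ge0 b0 (tent_ge0 b y).
have s0 := sqr_ge0 (x - y).
have [hx|hx] := leP x 2^-1; have [hy|hy] := leP y 2^-1; rewrite /= ?mulr1 ?mulr0; try lra.
- have := tent_sqr_ge b x y (2^-1 - x) (y - 2^-1) b0.
  rewrite ler0_norm ?[X in X = y - _ -> _]ger0_norm; [|lra|lra].
  move=> /(_ ltac:(lra) ltac:(lra)); lra.
- have := tent_sqr_ge b x y (x - 2^-1) (2^-1 - y) b0.
  rewrite ger0_norm ?[X in X = 2^-1 - _ -> _]ler0_norm; [|lra|lra].
  move=> /(_ ltac:(lra) ltac:(lra)); lra.
Qed.

(** * Integration against the measure of a copula *)

Lemma probability_setDX d1 d2 (T1 : measurableType d1) (T2 : measurableType d2)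
    (R : realType) (mu : probability (T1 * T2)%type R) (U V : set T1) (W : set T2) :
  measurable U -> measurable V -> measurable W -> U `<=` V ->
  (mu ((V `\` U) `*` W) = mu (V `*` W) - mu (U `*` W))%E.
Proof.
move=> mU mV mW UV.
rewrite (_ : _ `*` _ = (V `*` W) `\` (U `*` W)); last first.
  by apply/seteqP; split => [[x y] /= [[Vx Ux] Wy]|[x y] /= [[Vx Wy] UW]];
    split => //; [case|split => // Ux; apply: UW].
rewrite measureD; [|exact: measurableX|exact: measurableX|].
  by rewrite setIidr// => p [/= /UV].
by rewrite (le_lt_trans (probability_le1 mu _)) ?ltry//; exact: measurableX.
Qed.

Lemma probability_setXD d1 d2 (T1 : measurableType d1) (T2 : measurableType d2)
    (R : realType) (mu : probability (T1 * T2)%type R) (W : set T1) (U V : set T2) :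
  measurable U -> measurable V -> measurable W -> U `<=` V ->
  (mu (W `*` (V `\` U)) = mu (W `*` V) - mu (W `*` U))%E.
Proof.
move=> mU mV mW UV.
rewrite (_ : _ `*` _ = (W `*` V) `\` (W `*` U)); last first.
  by apply/seteqP; split => [[x y] /= [Wx [Vy Uy]]|[x y] /= [[Wx Vy] UW]];
    split => //; [case|split => // Uy; apply: UW].
rewrite measureD; [|exact: measurableX|exact: measurableX|].
  by rewrite setIidr// => p [/= ? /UV].
by rewrite (le_lt_trans (probability_le1 mu _)) ?ltry//; exact: measurableX.
Qed.

Lemma integral_add_indic2 d (T : measurableType d) (R : realType)
    (mu : {measure set T -> \bar R}) (D E1 E2 : set T) (f : T -> R) (k : R) :
  measurable D -> measurable E1 -> measurable E2 -> E1 `<=` D -> E2 `<=` D ->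
  measurable_fun setT f -> (forall x, D x -> 0 <= f x) -> 0 <= k ->
  (\int[mu]_(x in D) (f x + k * \1_E1 x + k * \1_E2 x)%:E
    = \int[mu]_(x in D) (f x)%:E + k%:E * mu E1 + k%:E * mu E2)%E.
Proof.
move=> mD m1 m2 s1 s2 mf f0 k0.
have mfE : measurable_fun D (fun x => (f x)%:E).
  by apply: measurable_funTS; exact/measurable_EFinP.
have m1E (E : set T) : measurable E -> measurable_fun D (fun x => (k * \1_E x)%:E).
  move=> mE; apply: measurable_funTS; apply/measurable_EFinP.
  by apply: measurable_funM.
have i1 (E : set T) : measurable E -> E `<=` D ->
    (\int[mu]_(x in D) (k * \1_E x)%:E = k%:E * mu E)%E.
  move=> mE ED; under eq_integral do rewrite EFinM.
  rewrite ge0_integralZl//.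
  - by rewrite integral_indic// setIidl.
  - by apply: measurable_funTS; exact/measurable_EFinP.
under eq_integral do rewrite !EFinD.
rewrite ge0_integralD//; first last.
- exact: m1E.
- by move=> x _; rewrite lee_fin mulr_ge0.
- by apply: emeasurable_funD => //; exact: m1E.
- by move=> x Dx; rewrite adde_ge0// lee_fin ?f0// mulr_ge0.
rewrite ge0_integralD//; first last.
- exact: m1E.
- by move=> x _; rewrite lee_fin mulr_ge0.
by rewrite !i1.
Qed.

(** The square has full mass, so each one-variable term integrates as over the plane, against a
    uniform marginal. All terms are nonnegative, so no integrability is required. *)
Lemma integral_add_marginals {R : realType} {C : R -> R -> R}
    {mu : probability (plane R) R} (hC : is_copula C) (hmu : has_joint_cdf C mu)
    (f : plane R -> R) (g : R -> R) :
  measurable_fun setT f -> (forall p, (`[0%R, 1%R] `*` `[0%R, 1%R]) p -> 0 <= f p) ->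
  measurable_fun setT g -> (forall x, 0 <= g x) ->
  (\int[mu]_(p in `[0%R, 1%R] `*` `[0%R, 1%R]) (f p + g p.1 + g p.2)%:E
    = \int[mu]_(p in `[0%R, 1%R] `*` `[0%R, 1%R]) (f p)%:E
      + \int[lebesgue_measure]_(x in `[0%R, 1%R]) (g x)%:E
      + \int[lebesgue_measure]_(x in `[0%R, 1%R]) (g x)%:E)%E.
Proof.
move=> mf f0 mg g0.
pose I : set (measurableTypeR R) := `[0%R, 1%R]%classic.
have mI : measurable I by exact: measurable_itv.
have mD : measurable (I `*` I : set (plane R)) by exact: measurableX.
have one01 : 0 <= (1 : R) <= 1 by rewrite ler01 lexx.
have D1 : mu (I `*` I) = 1%E by rewrite hmu// copula_u1.
have m1 : measurable_fun setT (fun p : plane R => (g p.1)%:E).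
  by apply/measurable_EFinP; apply: measurableT_comp => //; exact: measurable_fst.
have m2 : measurable_fun setT (fun p : plane R => (g p.2)%:E).
  by apply/measurable_EFinP; apply: measurableT_comp => //; exact: measurable_snd.
have mfE : measurable_fun setT (fun p => (f p)%:E) by exact/measurable_EFinP.
have e1 : (\int[mu]_(p in I `*` I) (g p.1)%:E =
    \int[lebesgue_measure]_(x in `[0%R, 1%R]) (g x)%:E)%E.
  rewrite ge0_integral_setI1//; last by move=> p; rewrite lee_fin.
  apply: (integral_uniform_marginal _ _ _ mu fst g measurable_fst mg g0).
  move=> u u01; have mu' : measurable (`[0%R, u]%classic : set (measurableTypeR R)).
    exact: measurable_itv.
  rewrite -(probability_setI1 _ _ _ mu (I `*` I))//; last first.
    by rewrite -[X in measurable X]setTI; exact: measurable_fst.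
  rewrite (_ : _ `&` _ = `[0%R, u]%classic `*` I); first by rewrite hmu// copula_u1.
  have /andP[_ u1] := u01.
  apply/seteqP; split => [[x y] /= [xu [_ Iy]]//|[x y] /= [xu Iy]]; split => //.
  split => //; move: xu; rewrite /I/= !in_itv/= => /andP[-> wu]/=; exact: le_trans u1.
have e2 : (\int[mu]_(p in I `*` I) (g p.2)%:E =
    \int[lebesgue_measure]_(x in `[0%R, 1%R]) (g x)%:E)%E.
  rewrite ge0_integral_setI1//; last by move=> p; rewrite lee_fin.
  apply: (integral_uniform_marginal _ _ _ mu snd g measurable_snd mg g0).
  move=> u u01; have mu' : measurable (`[0%R, u]%classic : set (measurableTypeR R)).
    exact: measurable_itv.
  rewrite -(probability_setI1 _ _ _ mu (I `*` I))//; last first.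
    by rewrite -[X in measurable X]setTI; exact: measurable_snd.
  rewrite (_ : _ `&` _ = I `*` `[0%R, u]%classic); first by rewrite hmu// copula_1v.
  have /andP[_ u1] := u01.
  apply/seteqP; split => [[x y] /= [yu [Ix _]]//|[x y] /= [Ix yu]]; split => //.
  split => //; move: yu; rewrite /I/= !in_itv/= => /andP[-> wu]/=; exact: le_trans u1.
under eq_integral do rewrite !EFinD.
rewrite ge0_integralD//; first last.
- exact: measurable_funTS.
- by move=> x _; rewrite lee_fin.
- by apply: emeasurable_funD; exact: measurable_funTS.
- by move=> x Dx; rewrite adde_ge0// lee_fin ?f0.
rewrite ge0_integralD//; first last.
- exact: measurable_funTS.
- by move=> x _; rewrite lee_fin.
- exact: measurable_funTS.
by rewrite -/I e1 e2.
Qed.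

Lemma copula_product_bounds {R : realType} {C : R -> R -> R}
    {mu : probability (plane R) R} (hC : is_copula C) (hmu : has_joint_cdf C mu) :
  6^-1 + C 2^-1 2^-1 ^+ 3
    <= \int[mu]_(p in `[0%R, 1%R] `*` `[0%R, 1%R]) (p.1 * p.2)
    <= 3^-1 - (2^-1 - C 2^-1 2^-1) ^+ 3.
Proof.
set a := C _ _; pose b := 2^-1 - a.
have half01 : 0 <= (2^-1 : R) <= 1 by apply/andP; split; lra.
have one01 : 0 <= (1 : R) <= 1 by rewrite ler01 lexx.
have /andP[a0 _] : 0 <= a <= 1 by exact: copula_range.
have ah : a <= 2^-1.
  have /andP[h0 h1] := half01.
  have := copula_increment_ge0 (copula_transpose hC) h0 h1 (lexx 1) half01.
  by rewrite copula_u1// subr_ge0.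
have b0 : 0 <= b by rewrite subr_ge0.
have bh : b <= 2^-1 by rewrite /b; lra.
pose I : set (measurableTypeR R) := `[0%R, 1%R]%classic.
pose L : set (measurableTypeR R) := `[0%R, 2^-1]%classic.
have mI : measurable I by exact: measurable_itv.
have mL : measurable L by exact: measurable_itv.
have LI : L `<=` I.
  by move=> x; rewrite /L/I/= !in_itv/=; lra.
have mH : measurable (I `\` L) by exact: measurableD.
have mD : measurable (I `*` I : set (plane R)) by exact: measurableX.
have muII : mu (I `*` I) = 1%E by rewrite hmu// copula_u1.
have muLL : mu (L `*` L) = a%:E by rewrite hmu.
have muLI : mu (L `*` I) = (2^-1)%:E by rewrite hmu// copula_u1.
have muIL : mu (I `*` L) = (2^-1)%:E by rewrite hmu// copula_1v.
have muHL : mu ((I `\` L) `*` L) = b%:E.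
  by rewrite (probability_setDX _ _ _ _ _ mu L I L mL mI mL LI) muIL muLL -EFinB.
have muLH : mu (L `*` (I `\` L)) = b%:E.
  by rewrite (probability_setXD _ _ _ _ _ mu L L I mL mI mL LI) muLI muLL -EFinB.
have muHH : mu ((I `\` L) `*` (I `\` L)) = a%:E.
  rewrite (probability_setDX _ _ _ _ _ mu L I (I `\` L) mL mI mH LI) muLH.
  rewrite (probability_setXD _ _ _ _ _ mu I L I mL mI mI LI) muII muIL -!EFinB; congr EFin.
  by rewrite /b; lra.
pose J := (\int[mu]_(p in I `*` I) (p.1 * p.2 : R)%:E)%E.
have mxy : measurable_fun setT (fun p : plane R => p.1 * p.2 : R).
  by apply: measurable_funM; [exact: measurable_fst|exact: measurable_snd].
have xy0 p : (I `*` I) p -> 0 <= p.1 * p.2 :> R.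
  by rewrite /I => -[/=]; rewrite !in_itv/= => /andP[x0 _] /andP[y0 _]; exact: mulr_ge0.
have sI (U V : set (measurableTypeR R)) : U `<=` I -> V `<=` I -> U `*` V `<=` I `*` I.
  by move=> UI VI p [/UI ? /VI ?].
have HI : I `\` L `<=` I by exact: subIsetl.
have indE (p : plane R) (U V : set (measurableTypeR R)) (s t : bool) :
    (U p.1 <-> s) -> (V p.2 <-> t) -> (\1_(U `*` V) p : R) = (s && t)%:R.
  move=> Us Vt; rewrite indicE; congr (_%:R); congr nat_of_bool.
  apply/idP/idP; first by rewrite inE => -[/= /Us -> /Vt ->].
  by move=> /andP[/Us Up /Vt Vp]; rewrite inE.
have LE (x : R) : I x -> (L x <-> x <= 2^-1).
  by rewrite /I/L/= !in_itv/= => /andP[-> _].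
have HE (x : R) : I x -> ((I `\` L) x <-> 2^-1 < x).
  by move=> Ix; have := LE _ Ix; rewrite ltNge => LEx; split => [[_ /LEx/negP]//|/negP nL];
    split => // /LEx.
have mind (k : R) (U V : set (measurableTypeR R)) : measurable U -> measurable V ->
    measurable_fun setT (fun p : plane R => k * \1_(U `*` V) p : R).
  move=> mU mV; apply: measurable_funM => //.
  by apply: measurable_indic; exact: measurableX.
(* The integrated [product_lower_bound]: 1/2 + 3 a^3 <= J + 2 (1/6 + a^3). *)
have lo : ((2^-1)%:E + (3 / 2 * a ^+ 2)%:E * a%:E + (3 / 2 * a ^+ 2)%:E * a%:E <=
    J + (6^-1 + a ^+ 3)%:E + (6^-1 + a ^+ 3)%:E)%E.
  rewrite -[X in (_ + _ * X + _ <= _)%E]muLL -[X in (_ + _ + _ * X <= _)%E]muHH.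
  rewrite -(integral_quad_tent _ 1 a) ?inE ?eqxx ?orbT ?a0//.
  rewrite -(integral_add_marginals hC hmu (fun p => p.1 * p.2) (quad_tent 1 a))//; last 2 first.
  - exact: measurable_quad_tent.
  - by move=> x; exact: quad_tent_ge0.
  have -> : (2^-1)%:E = (\int[mu]_(p in I `*` I) (cst 2^-1 p)%:E)%E.
    apply/esym/(etrans (integral_cst mu mD (2^-1)%:E)).
    by apply: etrans (congr1 (mule _) muII) _; rewrite mule1.
  rewrite -integral_add_indic2//; first last.
  - by rewrite mulr_ge0 ?sqr_ge0.
  - by move=> p _; rewrite /= invr_ge0.
  - exact: sI.
  - exact: sI.
  - exact: measurableX.
  - exact: measurableX.
  apply: ge0_le_integral => //.
  - by move=> p _; rewrite lee_fin !addr_ge0 ?mulr_ge0 ?sqr_ge0 ?invr_ge0.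
  - apply: measurable_funTS; apply/measurable_EFinP.
    by apply: measurable_funD; [apply: measurable_funD => //|]; exact: mind.
  - apply: measurable_funTS; apply/measurable_EFinP.
    apply: measurable_funD; first apply: measurable_funD => //.
      by apply: measurableT_comp; [exact: measurable_quad_tent|exact: measurable_fst].
    by apply: measurableT_comp; [exact: measurable_quad_tent|exact: measurable_snd].
  - move=> p [Ip1 Ip2]; rewrite lee_fin.
    rewrite (indE _ _ _ _ _ (LE _ Ip1) (LE _ Ip2)) (indE _ _ _ _ _ (HE _ Ip1) (HE _ Ip2)).
    exact: product_lower_bound.
(* The integrated [product_upper_bound]: J + 3 b^3 <= 2 (1/6 + b^3). *)
have up : (J + (3 / 2 * b ^+ 2)%:E * b%:E + (3 / 2 * b ^+ 2)%:E * b%:E <=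
    (6^-1 + b ^+ 3)%:E + (6^-1 + b ^+ 3)%:E)%E.
  rewrite -[X in (_ + _ * X + _ <= _)%E]muLH -[X in (_ + _ + _ * X <= _)%E]muHL.
  rewrite -(integral_quad_tent _ 0 b) ?inE ?eqxx ?b0//.
  (* A zero integrand is inserted to give the right side the shape required by
     [integral_add_marginals]. *)
  rewrite -[X in (_ <= X + _)%E]add0e.
  have -> : 0%E = (\int[mu]_(p in I `*` I) (cst 0 p)%:E)%E.
    exact/esym/integral0.
  rewrite -(integral_add_marginals hC hmu (cst 0) (quad_tent 0 b))//; last 2 first.
  - exact: measurable_quad_tent.
  - by move=> x; exact: quad_tent_ge0.
  rewrite -integral_add_indic2//; first last.
  - by rewrite mulr_ge0 ?sqr_ge0.
  - exact: sI.
  - exact: sI.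
  - exact: measurableX.
  - exact: measurableX.
  apply: ge0_le_integral => //.
  - by move=> p Ip; rewrite lee_fin addr_ge0 ?(addr_ge0 (xy0 _ Ip))// !mulr_ge0 ?sqr_ge0.
  - apply: measurable_funTS; apply/measurable_EFinP.
    by apply: measurable_funD; [apply: measurable_funD => //|]; exact: mind.
  - apply: measurable_funTS; apply/measurable_EFinP.
    apply: measurable_funD; first apply: measurable_funD => //.
      by apply: measurableT_comp; [exact: measurable_quad_tent|exact: measurable_fst].
    by apply: measurableT_comp; [exact: measurable_quad_tent|exact: measurable_snd].
  - move=> p [Ip1 Ip2]; rewrite lee_fin /cst add0r.
    rewrite (indE _ _ _ _ _ (LE _ Ip1) (HE _ Ip2)) (indE _ _ _ _ _ (HE _ Ip1) (LE _ Ip2)).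
    exact: product_upper_bound.
(* [lo] excludes J = -oo and [up] excludes J = +oo, so taking the real part of J loses nothing. *)
rewrite /Rintegral -/I -/J -/b; case: J lo up => [j| |]//=.
rewrite -!EFinM -!EFinD !lee_fin => lo up; apply/andP; split; lra.
Qed.

(** * From E[UV] to Blomqvist's beta *)

Lemma le_cbrt {R : realType} (t x : R) : 0 <= t -> t ^+ 3 <= x -> t <= cbrt x.
Proof.
move=> t0 tx; have x0 : 0 <= x by apply: le_trans tx; exact: exprn_ge0.
(* Zero is apart because its sign is 0: then [t ^+ 3 <= 0] forces t = 0. *)
have [x00|xn0] := eqVneq x 0.
  move: tx; rewrite x00 /cbrt sgr0 mul0r => t3.
  by rewrite leNgt; apply/negP => /(exprn_gt0 3); rewrite ltNge t3.
rewrite /cbrt gtr0_sg ?lt_neqAle ?x0 1?eq_sym ?xn0// mul1r ger0_norm//.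
have -> : t = (t ^+ 3) `^ 3^-1.
  by rewrite -powR_mulrn// -powRrM divff// powRr1.
by rewrite ge0_ler_powR// ?nnegrE// exprn_ge0.
Qed.

Lemma copula_measureP {R : realType} {C : R -> R -> R} (hC : is_copula C) :
  has_joint_cdf C (copula_measure C).
Proof. exact: (getPex (copula_measure_exists hC)). Qed.

Theorem corollary4 (R : realType) (C : R -> R -> R) (hC : is_copula C) :
  -1 <= spearman_rho C <= 1 /\
  beta_lower (spearman_rho C) <= blomqvist_beta C
    <= beta_upper (spearman_rho C).
Proof.
have := copula_product_bounds hC (copula_measureP hC).
rewrite /spearman_rho /concordance /indep_copula /blomqvist_beta.
set I := Rintegral _ _ _; set a := C _ _ => /andP[lo up].
have half01 : 0 <= (2^-1 : R) <= 1 by apply/andP; split; lra.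
have /andP[a0 _] : 0 <= a <= 1 by exact: copula_range.
have ah : a <= 2^-1.
  have /andP[h0 h1] := half01.
  have := copula_increment_ge0 (copula_transpose hC) h0 h1 (lexx 1) half01.
  by rewrite copula_u1// subr_ge0.
have b0 : 0 <= 2^-1 - a by rewrite subr_ge0.
have a3 := exprn_ge0 3 a0; have b3 := exprn_ge0 3 b0.
split; first by apply/andP; split; lra.
(* The constant branches are 0 <= a <= 1/2. Otherwise, with b = 1/2 - a, [up] reads (2b)^3 <= 2 (1 -
   rho) / 3 and gives the lower bound as beta = 1 - 2 (2b); [lo] reads (2a)^3 <= 2 (1 + rho) / 3 and
   gives the upper one as beta = -1 + 2 (2a). *)
apply/andP; split; rewrite /beta_lower /beta_upper; case: ifPn => _; try lra.
- have := le_cbrt (2 * (2^-1 - a)) (2 * (1 - 3 * (4 * I - 1)) / 3) _ _.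
  rewrite exprMn => /(_ ltac:(lra) ltac:(lra)); lra.
- have := le_cbrt (2 * a) (2 * (1 + 3 * (4 * I - 1)) / 3) _ _.
  rewrite exprMn => /(_ ltac:(lra) ltac:(lra)); lra.
Qed.
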